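(* Suppose that, for every uniform Eberlein compact space $K$ of weight at most $\mathfrak{c}$, the Banach space $C(K)$ embeds isometrically into $\ell_\infty/c_0$. Then $\mathfrak{c}$ is a Kunen cardinal.
   Context: $\mathfrak{c}=2^{\aleph_0}$. For a compact space $K$, $C(K)$ is the Banach space of continuous real-valued functions on $K$ with the supremum norm. $\ell_\infty/c_0$ is the quotient Banach space of bounded real sequences modulo sequences converging to $0$, with norm $\|[x]\|=\limsup_n |x(n)|$. A Banach space $X$ embeds isometrically into a Banach space $Y$ if there is a linear (not necessarily surjective) isometry $X\to Y$. The weight of a topological space is the least cardinality of a base. A compact space is uniform Eberlein if it is homeomorphic to a subset of a Hilbert space equipped with its weak topology; equivalently, if it embeds, for some index set $\Gamma$, into $B(\Gamma)=\{x\in[-1,1]^\Gamma:\sum_{\gamma\in\Gamma}|x_\gamma|\leqslant 1\}$ with the product topology. For a set $\Gamma$, $\mathcal{P}^2(\Gamma)$ is the $\sigma$-field of subsets of $\Gamma\times\Gamma$ generated by the sets $A_1\times A_2$ with $A_1,A_2\subseteq\Gamma$ arbitrary. A cardinal $\kappa$ is Kunen if $\mathcal{P}(\kappa\times\kappa)=\mathcal{P}^2(\kappa)$, i.e. every subset of $\kappa\times\kappa$ belongs to $\mathcal{P}^2(\kappa)$. *)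

(* Defs.v *)
From HB Require Import structures.
From mathcomp Require Import all_boot all_order all_algebra.
From mathcomp Require Import generic_quotient ring_quotient sesquilinear.
From mathcomp Require Import all_classical all_reals all_analysis.

Set Implicit Arguments.
Unset Strict Implicit.
Unset Printing Implicit Defensive.

Import Order.TTheory GRing.Theory Num.Theory.
Import numFieldNormedType.Exports.

Local Open Scope classical_set_scope.
Local Open Scope ring_scope.

Definition embeds_isometrically (R : realType) (X Y : normedModType R) : Prop :=
  exists T : {linear X -> Y}, forall x, `|T x| = `|x|.

Section ContinuousFunctions.
Context (R : realType) (K : topologicalType).

Definition continuous_pred : {pred K -> R^o} :=
  mem [set f : K -> R^o | continuous f].

Lemma continuous_predP (f : K -> R^o) : reflect (continuous f) (f \in continuous_pred).
Proof. exact: asboolP. Qed.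

Fact continuous_pred_submod : submod_closed continuous_pred.
Proof.
split; first by apply/continuous_predP => x; exact: cvg_cst.
move=> a u v /continuous_predP cu /continuous_predP cv.
apply/continuous_predP => x; apply: cvgD; last exact: cv.
by apply: cvgZl_tmp; exact: cu.
Qed.

HB.instance Definition _ := GRing.isSubmodClosed.Build R (K -> R^o)
  continuous_pred continuous_pred_submod.

(* Compactness of K is a parameter because it makes the supremum norm finite. *)
Definition continuous_functions (cK : compact [set: K]) :=
  {f : K -> R^o | f \in continuous_pred}.

Context (cK : compact [set: K]).
Local Notation CK := (continuous_functions cK).

HB.instance Definition _ := [isSub of CK for @sval _ _].
HB.instance Definition _ := [Choice of CK by <:].
HB.instance Definition _ := [SubChoice_isSubLmodule of CK by <:].

Definition sup_norm (f : CK) : R := sup (range (fun x => `|val f x|)).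

Lemma sup_norm_ub (f : CK) (x : K) : `|val f x| <= sup_norm f.
Proof.
have cf : continuous (val f) by apply/continuous_predP; exact: (valP f).
apply: ub_le_sup; last by exists x.
have /compact_bounded : compact (range (val f)).
  by apply: continuous_compact => //; apply: continuous_subspaceT.
case=> M [_ HM]; exists (M + 1) => _ [y _ <-].
by apply: (HM (M + 1)); [rewrite ltrDl|exists y].
Qed.

Lemma sup_norm_le (f : CK) (M : R) :
  0 <= M -> (forall x, `|val f x| <= M) -> sup_norm f <= M.
Proof.
move=> M0 fM; rewrite /sup_norm; have [->|r0] := eqVneq (range (fun x => `|val f x|)) set0.
  by rewrite sup0.
by apply: ge_sup; [exact/set0P|move=> _ [x _ <-]].
Qed.

Lemma sup_norm_ge0 (f : CK) : 0 <= sup_norm f.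
Proof.
rewrite /sup_norm; have [->|/set0P[_ [x _ _]]] := eqVneq (range (fun x => `|val f x|)) set0.
  by rewrite sup0.
exact: le_trans (sup_norm_ub f x).
Qed.

Fact sup_normD (f g : CK) : sup_norm (f + g) <= sup_norm f + sup_norm g.
Proof.
apply: sup_norm_le => [|x]; first by rewrite addr_ge0// sup_norm_ge0.
by apply: (le_trans (ler_normD _ _)); rewrite lerD// sup_norm_ub.
Qed.

Fact sup_norm_eq0 (f : CK) : sup_norm f = 0 -> f = 0.
Proof.
move=> f0; apply/val_inj/funext => x; apply/eqP.
by rewrite -normr_le0 -f0 sup_norm_ub.
Qed.

Fact sup_normZ (a : R) (f : CK) : sup_norm (a *: f) = `|a| * sup_norm f.
Proof.
have le b g : sup_norm (b *: g) <= `|b| * sup_norm g.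
  apply: sup_norm_le => [|x]; first by rewrite mulr_ge0// sup_norm_ge0.
  by rewrite -[val _ x]/(b * val g x) normrM ler_wpM2l// sup_norm_ub.
have [->|a0] := eqVneq a 0.
  apply/le_anti; rewrite le/= normr0 mul0r; exact: sup_norm_ge0.
apply/le_anti; rewrite le/= -ler_pdivlMl ?normr_gt0// -normfV.
by rewrite -{1}[f](scalerK a0) le.
Qed.

HB.instance Definition _ :=
  Lmodule_isNormed.Build R CK sup_normD sup_normZ sup_norm_eq0.

End ContinuousFunctions.

Section LinfModC0.
Context (R : realType).

Definition bounded_pred : {pred nat -> R^o} :=
  mem (bounded_fun : set (nat -> R^o)).

Lemma bounded_predP (u : nat -> R^o) :
  reflect (exists M, forall n, `|u n| <= M) (u \in bounded_pred).
Proof.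
have P : reflect (bounded_fun u) (u \in bounded_pred) by exact: asboolP.
apply: (iffP P) => [[M [_ HM]]|[M HM]].
  by exists (M + 1) => n; apply: HM => //; rewrite ltrDl.
exists M; split; first exact: num_real.
by move=> x /ltW Mx n _; exact: le_trans Mx.
Qed.

Fact bounded_pred_submod : submod_closed bounded_pred.
Proof.
split; first by apply/bounded_predP; exists 0 => n; rewrite normr0.
move=> a u v /bounded_predP[M uM] /bounded_predP[N vN].
apply/bounded_predP; exists (`|a| * M + N) => n.
apply: (le_trans (ler_normD _ _)); rewrite lerD// normrM.
by rewrite ler_wpM2l.
Qed.

HB.instance Definition _ := GRing.isSubmodClosed.Build R (nat -> R^o)
  bounded_pred bounded_pred_submod.

Definition linf := {u : nat -> R^o | u \in bounded_pred}.

HB.instance Definition _ := [isSub of linf for @sval _ _].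
HB.instance Definition _ := [Choice of linf by <:].
HB.instance Definition _ := [SubChoice_isSubLmodule of linf by <:].

Definition c0 : {pred linf} := mem [set u : linf | val u @ \oo --> (0 : R^o)].

Lemma c0P (u : linf) : reflect (val u @ \oo --> (0 : R^o)) (u \in c0).
Proof. exact: asboolP. Qed.

Fact c0_submod : submod_closed c0.
Proof.
split; first by apply/c0P; exact: cvg_cst.
move=> a u v /c0P u0 /c0P v0; apply/c0P.
rewrite -[0](addr0 (0 : R^o)); apply: cvgD => //.
by rewrite -(scaler0 R^o a); apply: cvgZl_tmp.
Qed.

HB.instance Definition _ := GRing.isSubmodClosed.Build R linf c0 c0_submod.

Definition linf_c0 := Quotient.quot c0.

HB.instance Definition _ := EqQuotient.on linf_c0.
HB.instance Definition _ := GRing.Zmodule.on linf_c0.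

Local Open Scope quotient_scope.

Lemma eq_linf_c0 (u v : linf) :
  reflect (\pi_linf_c0 u = \pi_linf_c0 v) (u - v \in c0).
Proof. by rewrite Quotient.idealrBE; exact: eqP. Qed.

Lemma piD_linf_c0 (u v : linf) :
  \pi_linf_c0 (u + v) = \pi_linf_c0 u + \pi_linf_c0 v.
Proof. exact: Quotient.pi_add. Qed.

Definition scale_linf_c0 (a : R) (q : linf_c0) : linf_c0 :=
  \pi_linf_c0 (a *: repr q).

Lemma scale_linf_c0_pi a u :
  scale_linf_c0 a (\pi_linf_c0 u) = \pi_linf_c0 (a *: u).
Proof.
apply/eq_linf_c0; rewrite -scalerBr rpredZ//.
by apply/eq_linf_c0; rewrite reprK.
Qed.

Fact scale_linf_c0A a b q :
  scale_linf_c0 a (scale_linf_c0 b q) = scale_linf_c0 (a * b) q.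
Proof. by rewrite -[q]reprK (scale_linf_c0_pi b) (scale_linf_c0_pi a) (scale_linf_c0_pi (a * b)) scalerA. Qed.

Fact scale_linf_c01 : left_id 1 scale_linf_c0.
Proof. by move=> q; rewrite -[q]reprK scale_linf_c0_pi scale1r. Qed.

Fact scale_linf_c0Dr : right_distributive scale_linf_c0 +%R.
Proof.
move=> a p q; rewrite -[p]reprK -[q]reprK -piD_linf_c0.
rewrite !(scale_linf_c0_pi a (repr _)) (scale_linf_c0_pi a (_ + _)).
by rewrite scalerDr piD_linf_c0.
Qed.

Fact scale_linf_c0Dl q : {morph scale_linf_c0^~ q : a b / a + b}.
Proof.
by move=> a b; rewrite -[q]reprK !(scale_linf_c0_pi _ (repr q)) scalerDl piD_linf_c0.
Qed.

HB.instance Definition _ := GRing.Zmodule_isLmodule.Build R linf_c0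
  scale_linf_c0A scale_linf_c01 scale_linf_c0Dr scale_linf_c0Dl.

(* [val u] has bounded absolute values, so [limn_sup] is their true limit
   superior; [linf_c0_normE] below shows that it passes to the quotient. *)
Definition limsup_norm (u : linf) : R := limn_sup (fun n => `|val u n|).

Let bounded_norm (u : linf) : bounded_fun (fun n => `|val u n| : R^o).
Proof.
have /bounded_predP[M uM] := valP u.
by apply/asboolP/bounded_predP; exists M => n; rewrite normr_id.
Qed.

Lemma limsup_norm_le (u : linf) (r : R) :
  (\forall n \near \oo, `|val u n| <= r) -> limsup_norm u <= r.
Proof.
move=> [N _ uN]; rewrite /limsup_norm limn_supE; last exact: bounded_norm.
apply: (@le_trans _ _ (sups (fun n => `|val u n|) N)).
  by apply: ge_inf; [exact/bounded_fun_has_lbound_sups/bounded_norm|exists N].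
apply: ge_sup; first by exists `|val u N|, N => /=.
by move=> _ [n /= Nn <-]; exact: uN.
Qed.

Lemma limsup_norm_lt (u : linf) (r : R) :
  limsup_norm u < r -> \forall n \near \oo, `|val u n| < r.
Proof.
rewrite /limsup_norm limn_supE; last exact: bounded_norm.
move=> /inf_lt[|_ [N _ <-] uN]; first by exists (sups (fun n => `|val u n|) 0%N), 0%N.
exists N => // n /= Nn; apply: le_lt_trans uN.
apply: ub_le_sup; last by exists n.
exact/has_ubound_sdrop/bounded_fun_has_ubound/bounded_norm.
Qed.

Lemma limsup_norm_ge0 (u : linf) : 0 <= limsup_norm u.
Proof.
rewrite leNgt; apply/negP => /limsup_norm_lt [N _ /(_ N (leqnn N))].
by rewrite /= ltNge normr_ge0.
Qed.

Lemma limsup_normD (u v : linf) :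
  limsup_norm (u + v) <= limsup_norm u + limsup_norm v.
Proof.
apply/ler_addgt0Pr => e e0; apply: limsup_norm_le.
have e2 : 0 < e / 2 by rewrite divr_gt0.
have := @limsup_norm_lt u (limsup_norm u + e / 2); rewrite ltrDl => /(_ e2) Hu.
have := @limsup_norm_lt v (limsup_norm v + e / 2); rewrite ltrDl => /(_ e2) Hv.
near=> n; apply: (le_trans (ler_normD _ _)).
rewrite [e in leRHS]splitr addrACA lerD// ltW//.
- by near: n.
- by near: n.
Unshelve. all: by end_near. Qed.

Lemma limsup_normZ (a : R) (u : linf) :
  limsup_norm (a *: u) = `|a| * limsup_norm u.
Proof.
have le b v : b != 0 -> limsup_norm (b *: v) <= `|b| * limsup_norm v.
  move=> b0; have nb0 : 0 < `|b| by rewrite normr_gt0.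
  apply/ler_addgt0Pr => e e0; apply: limsup_norm_le.
  have e2 : 0 < e / `|b| by rewrite divr_gt0.
  have := @limsup_norm_lt v (limsup_norm v + e / `|b|).
  rewrite ltrDl => /(_ e2) Hv; near=> n.
  rewrite -[val _ n]/(b * val v n) normrM mulrC -ler_pdivlMr// mulrDl.
  rewrite mulrAC divff ?gt_eqF// mul1r ltW//.
  by near: n.
have [->|a0] := eqVneq a 0.
  rewrite normr0 mul0r scale0r; apply/le_anti; rewrite limsup_norm_ge0 andbT.
  by apply: limsup_norm_le; apply: nearW => n; rewrite normr0.
apply/le_anti; rewrite le//= -ler_pdivlMl ?normr_gt0// -normfV.
by rewrite -{1}[u](scalerK a0) le// invr_eq0.
Unshelve. all: by end_near. Qed.

Lemma limsup_norm_eq0 (u : linf) : limsup_norm u = 0 <-> u \in c0.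
Proof.
split=> [u0|/c0P/cvgr0Pnorm_le u0].
  apply/c0P/cvgr0Pnorm_lt => e e0; apply: limsup_norm_lt; by rewrite u0.
apply/le_anti; rewrite limsup_norm_ge0 andbT.
by apply/ler_addgt0Pr => e e0; rewrite add0r; apply: limsup_norm_le; exact: u0.
Qed.

Lemma limsup_norm_mod (u v : linf) :
  u - v \in c0 -> limsup_norm u = limsup_norm v.
Proof.
have le w z : w - z \in c0 -> limsup_norm w <= limsup_norm z.
  move=> /limsup_norm_eq0 wz0; rewrite -[w](subrK z).
  by apply: (le_trans (limsup_normD _ _)); rewrite wz0 add0r.
by move=> uv; apply/le_anti; rewrite !le// -opprB rpredN.
Qed.

Definition linf_c0_norm (q : linf_c0) : R := limsup_norm (repr q).

Lemma linf_c0_normE (u : linf) : linf_c0_norm (\pi_linf_c0 u) = limsup_norm u.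
Proof. by apply: limsup_norm_mod; apply/eq_linf_c0; rewrite reprK. Qed.

Fact linf_c0_normD p q :
  linf_c0_norm (p + q) <= linf_c0_norm p + linf_c0_norm q.
Proof.
by rewrite -[p]reprK -[q]reprK -piD_linf_c0 !linf_c0_normE limsup_normD.
Qed.

Fact linf_c0_normZ (a : R) (q : linf_c0) :
  linf_c0_norm (a *: q) = `|a| * linf_c0_norm q.
Proof.
rewrite -[q]reprK -[a *: _]/(scale_linf_c0 _ _) scale_linf_c0_pi.
by rewrite !linf_c0_normE limsup_normZ.
Qed.

Fact linf_c0_norm_eq0 (q : linf_c0) : linf_c0_norm q = 0 -> q = 0.
Proof.
rewrite -[q]reprK linf_c0_normE => /limsup_norm_eq0 q0.
rewrite -[0](@pi_zeror _ _ _ _ _ (Quotient.quot c0)).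
by apply/eq_linf_c0; rewrite subr0.
Qed.

HB.instance Definition _ :=
  Lmodule_isNormed.Build R linf_c0 linf_c0_normD linf_c0_normZ linf_c0_norm_eq0.

End LinfModC0.

(* The scalars are real, so the dot product is symmetric ([idfun] in place of
   a conjugation). *)
Definition is_hilbert_space (R : realType) (H : completeNormedModType R) : Prop :=
  exists ip : {dot H for idfun}, forall x : H, `|x| ^+ 2 = ip x x.

Section WeakTopology.
Context (R : realType) (H : normedModType R).

Definition dual := {phi : {linear H -> R^o} | continuous phi}.

(* [initial_topology] for the map of H into the functions on its dual with the
   pointwise topology: the coarsest topology making every continuous linear
   functional continuous. *)
Definition weak_topology :=
  initial_topology
    (fun (x : H) => (fun phi => sval phi x) : {ptws dual -> R^o}).

HB.instance Definition _ := Topological.on weak_topology.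

End WeakTopology.

Definition homeomorphic (X Y : topologicalType) : Prop :=
  exists (f : X -> Y) (g : Y -> X),
    [/\ continuous f, continuous g, cancel f g & cancel g f].

(* [A] is seen as a topological space with the topology induced by the weak
   topology of H. *)
Definition uniform_eberlein (R : realType) (K : topologicalType) : Prop :=
  compact [set: K] /\
  exists (H : completeNormedModType R) (A : set (weak_topology H)),
    is_hilbert_space H /\ homeomorphic K A.

Definition continuum : Type := nat -> bool.

(* Cardinals are represented by types of that cardinality: [weight_le K C] says
   that the weight of K is at most the cardinality of C. *)
Definition weight_le (K : topologicalType) (C : Type) : Prop :=
  exists B : set (set K), basis B /\ (B #<= [set: C])%card.

Definition rectangles (T : Type) : set (set (T * T)) :=
  [set A1 `*` A2 | A1 in [set: set T] & A2 in [set: set T]].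

(* This depends only on the cardinality of T. *)
Definition kunen (T : Type) : Prop :=
  forall E : set (T * T), <<s @rectangles T >> E.

(* Main.v *)
From HB Require Import structures.
Require Import Defs.
From mathcomp Require Import all_boot all_order all_algebra finmap.
From mathcomp Require Import generic_quotient sesquilinear ring lra.
From mathcomp Require Import all_classical all_reals all_analysis.

(* For a set E of pairs of points of the continuum G, let K be the set of the
   pairs (x, y) of points of the one-point compactification of the discrete
   space G such that x or y is the point at infinity or (x, y) is in E.  It is
   obtained from a compact space by removing isolated points, and sending (x, y)
   to the sum of the two corresponding orthonormal vectors (0 at infinity) embeds
   it into a Hilbert space with its weak topology, since orthonormal families
   converge weakly to 0.  Let f_a and g_b be the indicator functions of x = a and
   of y = b: the norm of f_a + g_b is 2 if (a, b) is in E, and at most 1 otherwise.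
   If bounded sequences u_a and v_b represent the images of f_a and g_b under an
   isometry from C(K) to l_oo/c_0, then (a, b) is in E if and only if
   3/2 < |u_a(n) + v_b(n)| for infinitely many n, and for each n this is a
   condition measurable for the sigma-algebra generated by rectangles. *)

Set Implicit Arguments.
Unset Strict Implicit.
Unset Printing Implicit Defensive.

Import Order.TTheory GRing.Theory Num.Theory.
Import numFieldNormedType.Exports.

Local Open Scope classical_set_scope.
Local Open Scope ring_scope.

(** * The Hilbert space of square-summable families *)

Section UnorderedSums.
Context (R : realType) (I : choiceType).
Implicit Types (f g : I -> R) (A B : {fset I}).

(** Convergence along this filter is convergence of the net of finite partial sums, that is,
    unordered summation. *)
Definition totally : set_system {fset I} :=
  filter_from setT (fun A => [set B | (A `<=` B)%fset]).

#[global] Instance totally_filter : ProperFilter totally.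
Proof.
eapply filter_from_proper; last by move=> A _; exists A; rewrite /= fsubset_refl.
apply: filter_fromT_filter; first by exists fset0.
by move=> A B /=; exists (A `|` B)%fset => C /=; rewrite fsubUset => /andP[].
Qed.

Definition psum f A : R := \sum_(i <- A) f i.

Definition usum f : R := lim (psum f @ totally).

Definition summable_fun f := exists M, forall A, psum (fun i => `|f i|) A <= M.

Lemma le_psum f A B : (forall i, 0 <= f i) -> (A `<=` B)%fset ->
  psum f A <= psum f B.
Proof.
move=> f0 AB; rewrite /psum.
rewrite [leLHS](_ : _ = \sum_(i <- A) (if i \in A then f i else 0)); last first.
  by rewrite [LHS]big_seq [RHS]big_seq; apply: eq_bigr => i ->.
rewrite (big_fset_incl _ AB) => [|i _ /negbTE ->//].
by apply: ler_sum => i _; case: ifP.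
Qed.

Lemma psumD f g A : psum (f \+ g) A = psum f A + psum g A.
Proof. exact: big_split. Qed.

Lemma psumZ a f A : psum (fun i => a * f i) A = a * psum f A.
Proof. by rewrite /psum -mulr_sumr. Qed.

Lemma ge0_psum_cvg f M : (forall i, 0 <= f i) -> (forall A, psum f A <= M) ->
  psum f @ totally --> sup (range (psum f)).
Proof.
move=> f0 fM.
have ubf : has_ubound (range (psum f)) by exists M => _ [A _ <-].
apply/cvgrPdist_lt => e e0.
have [|_ [A _ <-] lA] := @sup_adherent _ (range (psum f)) e e0.
  by split=> //; exists (psum f fset0), fset0.
exists A => // B /= AB.
have lB : psum f B <= sup (range (psum f)) by apply: ub_le_sup => //; exists B.
rewrite ger0_norm ?subr_ge0// ltrBlDr -ltrBlDl.
exact: lt_le_trans lA (le_psum _ _).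
Qed.

(** The family is the difference of the nonnegative families |f| + f and |f|, whose finite sums are
    bounded by 2M and M and hence converge to their suprema. *)
Lemma psum_cvg f : summable_fun f -> psum f @ totally --> usum f.
Proof.
case=> M fM; suff H : cvg (psum f @ totally) by exact: H.
have -> : psum f = psum (fun i => `|f i| + f i) \- psum (fun i => `|f i|).
  by apply/funext => A; rewrite /= -[in RHS]/(psum ((fun i => `|f i|) \+ f) A) psumD addrAC subrr add0r.
apply: is_cvgB; apply/cvg_ex; eexists;
  [apply: (@ge0_psum_cvg _ (2 * M))|exact: (@ge0_psum_cvg _ M)].
- by move=> i; rewrite addrC -lerBlDr sub0r lerNnormlW.
- move=> A; apply: (@le_trans _ _ (2 * psum (fun i => `|f i|) A)).
    rewrite -psumZ; apply: ler_sum => i _.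
    by rewrite mulr2n mulrDl mul1r lerD2l ler_norm.
  by rewrite ler_wpM2l.
Qed.

Lemma summable_funZ a f : summable_fun f -> summable_fun (fun i => a * f i).
Proof.
move=> [M fM]; exists (`|a| * M) => A.
have -> : (fun i => `|a * f i|) = (fun i => `|a| * `|f i|).
  by apply/funext => i; rewrite normrM.
by rewrite psumZ ler_wpM2l.
Qed.

Lemma usumD f g : summable_fun f -> summable_fun g ->
  usum (f \+ g) = usum f + usum g.
Proof.
move=> sf sg; apply/cvg_lim => //.
rewrite (_ : psum (f \+ g) = psum f \+ psum g); last by apply/funext => A; exact: psumD.
by apply: cvgD; exact: psum_cvg.
Qed.

Lemma usumZ a f : summable_fun f -> usum (fun i => a * f i) = a * usum f.
Proof.
move=> sf; apply/cvg_lim => //.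
rewrite (_ : psum _ = (fun A => a * psum f A)); last by apply/funext => A; exact: psumZ.
by apply: cvgMr; exact: psum_cvg.
Qed.

Lemma psum_le_usum f A : (forall i, 0 <= f i) -> summable_fun f ->
  psum f A <= usum f.
Proof.
move=> f0 sf; apply: limr_ge; first exact: psum_cvg.
by exists A => // B; exact: le_psum.
Qed.

Lemma usum_le f M : summable_fun f -> (forall A, psum f A <= M) -> usum f <= M.
Proof.
move=> sf fM; apply: limr_le; first exact: psum_cvg.
exact: nearW.
Qed.

End UnorderedSums.

(** * The space of square-summable families: inner product, norm and completeness *)

Section Ell2.
Context (R : realType) (I : choiceType).

Definition ell2_pred : {pred I -> R^o} :=
  mem [set u : I -> R^o | exists M, forall A, psum (fun i => u i ^+ 2 : R) A <= M].

Lemma ell2_predP (u : I -> R^o) :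
  reflect (exists M, forall A, psum (fun i => u i ^+ 2 : R) A <= M) (u \in ell2_pred).
Proof. exact: asboolP. Qed.

Fact ell2_submod_closed : submod_closed ell2_pred.
Proof.
split; first by apply/ell2_predP; exists 0 => A; rewrite /psum big1// => i _; rewrite expr0n.
move=> a u v /ell2_predP[M uM] /ell2_predP[N vN].
(* The bound comes from (au + v)^2 <= 2 a^2 u^2 + 2 v^2, the difference being (au - v)^2. *)
apply/ell2_predP; exists (2 * a ^+ 2 * M + 2 * N) => A.
apply: (@le_trans _ _ (2 * a ^+ 2 * psum (fun i => u i ^+ 2 : R) A + 2 * psum (fun i => v i ^+ 2 : R) A)).
  rewrite -!psumZ -psumD; apply: ler_sum => i _ /=.
  rewrite -[(a *: u + v) i]/(a * u i + v i) -subr_ge0.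
  rewrite (_ : _ - _ = (a * u i - v i) ^+ 2); last by ring.
  exact: sqr_ge0.
by apply: lerD; rewrite ler_wpM2l// mulr_ge0// sqr_ge0.
Qed.

HB.instance Definition _ := GRing.isSubmodClosed.Build R (I -> R^o)
  ell2_pred ell2_submod_closed.

Definition ell2 := {u : I -> R^o | u \in ell2_pred}.

HB.instance Definition _ := [isSub of ell2 for @sval _ _].
HB.instance Definition _ := [Choice of ell2 by <:].
HB.instance Definition _ := [SubChoice_isSubLmodule of ell2 by <:].

Implicit Types u v w : ell2.

Definition ip u v : R := usum (fun i => val u i * val v i).

(** Termwise |uv| <= u^2 + v^2, so the bounds on the sums of squares add up. *)
Lemma summable_ip u v : summable_fun (fun i => val u i * val v i : R).
Proof.
have /ell2_predP[M uM] := valP u; have /ell2_predP[N vN] := valP v.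
exists (M + N) => A; apply: le_trans (lerD (uM A) (vN A)); rewrite -psumD.
apply: ler_sum => i _ /=; rewrite normrM.
rewrite -[(val u i) ^+ 2]real_normK ?num_real// -[(val v i) ^+ 2]real_normK ?num_real//.
set x := `|_|; set y := `|_|.
rewrite -subr_ge0 (_ : _ - _ = (x - y) ^+ 2 + x * y); last by ring.
apply: addr_ge0; first exact: sqr_ge0.
by apply: mulr_ge0; exact: normr_ge0.
Qed.

Lemma ipC u v : ip u v = ip v u.
Proof. by rewrite /ip; congr usum; apply/funext => i; rewrite mulrC. Qed.

Lemma ipPl a u v w : ip (a *: u + v) w = a * ip u w + ip v w.
Proof.
rewrite /ip -usumZ; last exact: summable_ip.
rewrite -usumD; [|exact/summable_funZ/summable_ip|exact: summable_ip].
by congr usum; apply/funext => i /=; rewrite mulrA -mulrDl.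
Qed.

Lemma ipPr a u v w : ip w (a *: u + v) = a * ip w u + ip w v.
Proof. by rewrite ipC ipPl !(ipC w). Qed.

Lemma psum_le_ip u A : psum (fun i => val u i ^+ 2 : R) A <= ip u u.
Proof. by apply: psum_le_usum => [i|]; [exact: sqr_ge0|exact: summable_ip]. Qed.

Lemma ip_le u M : (forall A, psum (fun i => val u i ^+ 2 : R) A <= M) -> ip u u <= M.
Proof. exact/usum_le/summable_ip. Qed.

Lemma ip_ge0 u : 0 <= ip u u.
Proof. by have := psum_le_ip u fset0; rewrite /psum big_seq_fset0. Qed.

Lemma sqr_coord_le u i : val u i ^+ 2 <= ip u u.
Proof. by have := psum_le_ip u [fset i]%fset; rewrite /psum big_seq_fset1. Qed.

Lemma ip_eq0 u : ip u u = 0 -> u = 0.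
Proof.
move=> u0; apply/val_inj/funext => i; apply/eqP.
by rewrite -(@sqrf_eq0 R) eq_le sqr_ge0 andbT -u0 sqr_coord_le.
Qed.

Lemma ip0r u : ip u 0 = 0.
Proof.
have -> : 0 = (-1) *: 0 + 0 :> ell2 by rewrite scaler0 addr0.
by rewrite ipPr mulN1r addNr.
Qed.

Lemma ip_CauchySchwarz u v : ip u v ^+ 2 <= ip u u * ip v v.
Proof.
have [v0|v0] := eqVneq (ip v v) 0.
  by rewrite v0 (ip_eq0 v0) ip0r mulr0 expr0n.
have vp : 0 < ip v v by rewrite lt_def v0 ip_ge0.
(* This vector is [u] minus its orthogonal projection on [v]; its squared norm times [ip v v] is the
   difference of the two sides. *)
have := ip_ge0 ((- (ip u v / ip v v)) *: v + u).
rewrite ipPl !ipPr (ipC v u) => /mulr_ge0 /(_ (ltW vp)) H.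
by rewrite -subr_ge0; apply: le_trans H _; rewrite le_eqVlt; apply/orP; left; apply/eqP; field.
Qed.

Definition ell2_norm u := Num.sqrt (ip u u).

Lemma ell2_norm_sqr u : ell2_norm u ^+ 2 = ip u u.
Proof. by rewrite sqr_sqrtr// ip_ge0. Qed.

Fact ell2_normD u v : ell2_norm (u + v) <= ell2_norm u + ell2_norm v.
Proof.
have n0 w : 0 <= ell2_norm w by exact: sqrtr_ge0.
rewrite -(@ler_pXn2r _ 2)// ?nnegrE ?addr_ge0// sqrrD !ell2_norm_sqr.
rewrite -[u in ip (u + v)]scale1r -[u in ip _ (u + v)]scale1r ipPl !ipPr.
rewrite !mul1r (ipC v u).
have : ip u v <= ell2_norm u * ell2_norm v.
  apply: le_trans (ler_norm _) _.
  rewrite -(@ler_pXn2r _ 2)// ?nnegrE ?mulr_ge0// real_normK ?num_real//.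
  by rewrite exprMn !ell2_norm_sqr ip_CauchySchwarz.
by rewrite mulr2n; lra.
Qed.

Fact ell2_normZ a u : ell2_norm (a *: u) = `|a| * ell2_norm u.
Proof.
rewrite /ell2_norm -sqrtr_sqr -sqrtrM ?sqr_ge0//; congr Num.sqrt.
by rewrite -[a *: u]addr0 ipPl ipPr (ipC 0) !ip0r !addr0 mulrA.
Qed.

Fact ell2_norm_eq0 u : ell2_norm u = 0 -> u = 0.
Proof. by move=> u0; apply: ip_eq0; rewrite -ell2_norm_sqr u0 expr0n. Qed.

HB.instance Definition _ :=
  Lmodule_isNormed.Build R ell2 ell2_normD ell2_normZ ell2_norm_eq0.

Lemma sqr_normE u : `|u| ^+ 2 = ip u u.
Proof. exact: ell2_norm_sqr. Qed.

Lemma coord_le u i : `|val u i| <= `|u|.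
Proof.
rewrite -(@ler_pXn2r _ 2)// ?nnegrE// real_normK ?num_real//.
by rewrite sqr_normE sqr_coord_le.
Qed.

(** Coordinates are 1-Lipschitz, so they converge along [F] to a family [g]. Passing to the limit in
    finite sums of (u - v)^2 gives a bound uniform in the finite set, from which follow both the
    membership of [g] and the convergence in norm. *)
Fact ell2_complete (F : set_system ell2) : ProperFilter F -> cauchy F -> cvg F.
Proof.
move=> FF /cauchyP Fc.
have cvgF i : cvg ((fun u => val u i) @ F).
  apply: cauchy_cvg; apply/cauchyP => e e0; have [u Fu] := Fc e e0.
  exists (val u i : R^o); rewrite -[_ (ball _ _)]/(F [set w | ball (val u i : R^o) e (val w i)]).
  apply: filterS Fu => v /=.
  rewrite -!ball_normE /= => uv; apply: le_lt_trans uv.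
  exact: (coord_le (u - v)).
pose g i : R^o := lim ((fun u => val u i) @ F).
have psum_cvgF (u : ell2) (A : {fset I}) : (fun v => psum (fun i => (val u i - val v i) ^+ 2 : R) A) @ F -->
    psum (fun i => (val u i - g i) ^+ 2 : R) A.
  apply: cvg_big => [|i _ /=]; first exact: add_continuous.
  by apply: cvgM; apply: cvgB; [exact: cvg_cst|exact: cvgF|exact: cvg_cst|exact: cvgF].
have gF e : 0 < e -> \forall u \near F, forall A,
    psum (fun i => (val u i - g i) ^+ 2 : R) A <= e ^+ 2.
  move=> e0; have [w Fw] := Fc (e / 2) (divr_gt0 e0 (ltr0n _ 2)).
  apply: filterS (Fw) => u wu A.
  rewrite -(cvg_lim _ (psum_cvgF u A))//.
  apply: limr_le; first by apply/cvg_ex; eexists; exact: psum_cvgF.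
  apply: filterS Fw => v wv.
  have uv : `|u - v| <= e.
    apply: ltW; have := ball_splitr wu wv; by rewrite -ball_normE.
  apply: le_trans (psum_le_ip (u - v) A) _.
  rewrite -sqr_normE ler_pXn2r// ?nnegrE ?normr_ge0//.
  exact: ltW.
(* A single [u0] at finite distance from [g] suffices: [g] is the difference of [u0] and [u0 - g],
   both square-summable. *)
have [u0 Hu0] := filter_ex (gF 1 ltr01).
have du0 : (val u0 - g) \in ell2_pred by apply/ell2_predP; exists (1 ^+ 2) => A; exact: Hu0.
have gl : g \in ell2_pred.
  by rewrite -[g](subKr (val u0)) rpredB//; exact: valP.
apply/cvg_ex; exists (exist _ g gl : ell2).
apply/cvgrPdist_le => e e0; apply: filterS (gF _ e0) => u Hu.
rewrite distrC -(@ler_pXn2r _ 2)// ?nnegrE ?(ltW e0)// sqr_normE.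
exact: ip_le.
Qed.

HB.instance Definition _ := Uniform_isComplete.Build ell2 ell2_complete.

Fact ip_bilinear : bilinear_for (GRing.Scale.Law.clone _ _ ( *%R ) _)
  (GRing.Scale.Law.clone _ _ (idfun \; *%R ) _) ip.
Proof. by split=> w a u v /=; rewrite ?ipPl ?ipPr. Qed.

HB.instance Definition _ := bilinear_isBilinear.Build R ell2 ell2 R _ _ ip ip_bilinear.

Fact ip_hermitian u v : ip u v = (-1) ^+ false * idfun (ip v u).
Proof. by rewrite expr0 mul1r ipC. Qed.

HB.instance Definition _ := isHermitianSesquilinear.Build R ell2 false idfun ip ip_hermitian.

Fact ip_gt0 u : u != 0 -> 0 < ip u u.
Proof.
by move=> u0; rewrite lt_def ip_ge0 andbT; apply: contraNneq u0 => /ip_eq0 ->.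
Qed.

HB.instance Definition _ := isDotProduct.Build R ell2 ip ip_gt0.

Lemma ell2_hilbert : is_hilbert_space ell2.
Proof. by exists ip => u; rewrite sqr_normE. Qed.

End Ell2.

(** * The standard orthonormal basis, coordinate functionals and weak convergence to 0 *)

Section Ell2Basis.
Context (R : realType) (I : choiceType).
Local Notation H := (ell2 R I).

Definition delta_fun (i : I) : I -> R^o := fun j => (j == i)%:R.

Lemma psum_supp1 (f : I -> R) (i : I) (A : {fset I}) :
  (forall j, j != i -> f j = 0) -> psum f A = if i \in A then f i else 0.
Proof.
move=> fi; rewrite /psum; case: ifPn => iA.
  rewrite (big_fsetD1 i)//= big_seq big1 ?addr0// => j.
  by rewrite !inE => /andP[ji _]; exact: fi.
rewrite big_seq big1// => j jA; apply: fi.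
by apply: contraNneq iA => <-.
Qed.

Fact delta_fun_ell2 i : delta_fun i \in @ell2_pred R I.
Proof.
apply/ell2_predP; exists 1 => A; rewrite (@psum_supp1 _ i) => [|j /negbTE ji].
  by case: ifP => _; rewrite ?ler01// /delta_fun eqxx expr1n.
by rewrite /delta_fun ji expr0n.
Qed.

Definition delta i : H := Sub (delta_fun i) (delta_fun_ell2 i).

Lemma ip_delta i (u : H) : ip (delta i) u = val u i.
Proof.
apply/cvg_lim => //; apply: cvg_near_cst; exists [fset i]%fset => // A /= iA.
rewrite (@psum_supp1 _ i) => [|j /negbTE ji]; last by rewrite /delta_fun ji mul0r.
by rewrite (fsubsetP iA) ?inE// /delta_fun eqxx mul1r.
Qed.

Definition coord (i : I) : H -> R^o := fun u => val u i.

Fact coord_linear i : linear (coord i).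
Proof. by []. Qed.

HB.instance Definition _ i := GRing.isLinear.Build R H R^o _ (coord i) (coord_linear i).

Fact coord_continuous i : continuous (coord i).
Proof.
apply/bounded_linear_continuous/linear_boundedP.
near=> r => x; apply: le_trans (coord_le x i) _.
by rewrite ler_peMl//; near: r; exact: nbhs_pinfty_ge.
Unshelve. all: by end_near. Qed.

Definition coord_dual i : dual H :=
  exist (fun phi : {linear H -> R^o} => continuous phi) (coord i) (@coord_continuous i).

(** At the test vector x, the sum over [A] of phi(delta i) delta i, both phi(x) and |x|^2 equal the
    finite sum s; continuity gives |x|^2 <= C|x|, whence s <= C^2. *)
Lemma bessel (phi : dual H) :
  exists C, forall A, psum (fun i => (sval phi (delta i)) ^+ 2 : R) A <= C.
Proof.
case: phi => phi cphi /=.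
have /linear_boundedP[C [_ /(_ (C + 1))]] := continuous_linear_bounded 0 (cphi 0).
rewrite ltrDl => /(_ ltr01); move: (C + 1) => {}C Cphi.
exists (C ^+ 2) => A; set s := psum _ _.
pose x : H := \sum_(i <- A) phi (delta i) *: delta i.
have coordx i : i \in A -> val x i = phi (delta i).
  move=> iA; rewrite -[LHS]/(coord i x) linear_sum /=.
  rewrite -[LHS]/(psum (fun j => coord i (phi (delta j) *: delta j)) A).
  rewrite (@psum_supp1 _ i) => [|j ji]; rewrite linearZ /= /coord /= /delta_fun.
    by rewrite iA eqxx [_ *: _]mulr1.
  by rewrite eq_sym (negbTE ji) scaler0.
have phix : phi x = s.
  by rewrite linear_sum; apply: eq_bigr => i _; rewrite linearZ.
have xx : `|x| ^+ 2 = s.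
  rewrite sqr_normE {2}/x linear_sumr /s /psum big_seq [RHS]big_seq.
  by apply: eq_bigr => i iA; rewrite linearZr_LR /= ipC ip_delta coordx.
have s0 : 0 <= s by rewrite -xx sqr_ge0.
have := Cphi x; rewrite phix ger0_norm// -xx.
have [->|x0] := eqVneq `|x| 0; first by rewrite expr0n /= sqr_ge0.
rewrite expr2 ler_pM2r ?lt_def ?x0//= => xC.
by rewrite -expr2 ler_pXn2r ?nnegrE// (le_trans _ xC).
Qed.

Lemma infinite_psum_unbounded (f : I -> R) (D : set I) (e : R) :
  infinite_set D -> 0 < e -> (forall i, 0 <= f i) ->
  (forall i, D i -> e <= f i) -> forall C, exists A, C < psum f A.
Proof.
move=> Dinf e0 f0 Df C.
(* [B] consists of more than C/e points of [D], each contributing at least [e]. *)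
have [B BD sB] := infinite_set_fset (Num.truncn (C / e)).+1 Dinf.
exists B; apply: (@lt_le_trans _ _ (#|` B|%:R * e)).
  rewrite -ltr_pdivrMr//; apply: (lt_le_trans (truncnS_gt _)).
  by rewrite ler_nat.
rewrite /psum (@le_trans _ _ (\sum_(i <- B) e))//.
  by rewrite big_const_seq count_predT iter_addr addr0 mulr_natl.
by rewrite big_seq [leRHS]big_seq; apply: ler_sum => i iB; exact/Df/BD.
Qed.

(** Infinitely many such indices would contradict the bound of [bessel]. This is the weak
    convergence of the orthonormal basis to 0. *)
Lemma dual_delta_finite (phi : dual H) (e : R) : 0 < e ->
  finite_set [set i | e <= `|sval phi (delta i)|].
Proof.
move=> e0; apply: contrapT => inf.
have [C phiC] := bessel phi.
have [//|i|i ie|A] := @infinite_psum_unbounded (fun i => (sval phi (delta i)) ^+ 2 : R) _ (e ^+ 2) inf _ _ _ C.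
- by rewrite exprn_gt0.
- exact: sqr_ge0.
- by rewrite -[leRHS]real_normK ?num_real// ler_pXn2r ?nnegrE ?(ltW e0).
- by rewrite ltNge phiC.
Qed.
End Ell2Basis.

(** * Weak topologies and compact spaces *)

Lemma cvg_initial (S : choiceType) (T : topologicalType) (g : S -> T)
    (F : set_system S) (s : S) : Filter F ->
  g @ F --> g s -> F --> (s : initial_topology g).
Proof.
move=> FF gF A [_ [[B oB <-] Bs BA]]; apply: filterS BA _.
by apply: gF; exact: open_nbhs_nbhs.
Qed.

Section WeakTopologyContinuity.
Context (R : realType) (H : normedModType R).

Lemma weak_topology_continuous (T : topologicalType) (f : T -> weak_topology H) :
  (forall phi : dual H, continuous (fun t => sval phi (f t) : R^o)) ->
  continuous f.
Proof.
(* The weak topology is initial for evaluation, and the pointwise topology is the supremum of the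
   initial topologies of its projections; hence two uses of [cvg_initial]. *)
move=> cf t; apply: cvg_initial; apply/cvg_sup => phi.
by apply: cvg_initial; exact: cf.
Qed.

Lemma dual_weak_continuous (phi : dual H) :
  continuous (sval phi : weak_topology H -> R^o).
Proof.
pose ev (x : H) : {ptws dual H -> R^o} := fun psi => sval psi x.
move=> x; apply: (@continuous_comp (weak_topology H) {ptws dual H -> R^o} R^o ev (fun f => f phi)).
  exact: (@initial_continuous _ _ ev).
have /cvg_sup/(_ phi) h : nbhs (ev x) --> ev x by exact: cvg_id.
apply: cvg_trans (@initial_continuous _ _ (fun f : dual H -> R^o => f phi) (ev x)).
exact: cvg_app h.
Qed.

End WeakTopologyContinuity.

Lemma set_type_compact (T : topologicalType) (A : set T) :
  compact A -> compact [set: A].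
Proof.
move=> cA F FF _.
have [|x [Ax Fx]] := cA (set_val @ F) _.
  by rewrite -[_ A]/(F (set_val @^-1` A)); apply: filterS filterT => x _; exact: set_valP.
exists (exist _ x (mem_set Ax)); split=> // B C FB [_ [[W oW <-] Wx WC]].
have [||_ [[y By <-] Wy]] := Fx (set_val @` B) W.
- by rewrite -[_ (_ @` _)]/(F (set_val @^-1` _)); apply: filterS FB; exact: preimage_image.
- exact: open_nbhs_nbhs.
- by exists y; split => //; exact: WC.
Qed.

Lemma separated_hausdorff (R : realType) (T : topologicalType) :
  (forall x y : T, x <> y -> exists2 f : T -> R^o, continuous f & f x <> f y) ->
  hausdorff_space T.
Proof.
move=> sep x y xy; apply: contrapT => /sep[f cf]; apply.
apply: (@Rhausdorff R) => A B nA nB.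
have [z [Az Bz]] := xy _ _ (cf _ _ nA) (cf _ _ nB).
by exists (f z).
Qed.

(** A closed set of [X] is compact, so its image under [f], which is its preimage under [g], is
    compact and therefore closed in [Y]. *)
Lemma compact_inverse_continuous (X Y : topologicalType) (f : X -> Y) (g : Y -> X) :
  compact [set: X] -> hausdorff_space Y -> continuous f ->
  cancel f g -> cancel g f -> continuous g.
Proof.
move=> cX hY cf fK gK; apply/continuous_closedP => C cC.
have -> : g @^-1` C = f @` C.
  by apply/seteqP; split=> [y Cy|_ [x Cx <-]]; [exists (g y)|rewrite /= fK].
apply: compact_closed => //; apply: continuous_compact.
  exact: continuous_subspaceT.
exact: subclosed_compact cX _.
Qed.

Lemma compact_discrete_finite (T : discreteTopologicalType) (A : set T) :
  compact A -> finite_set A.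
Proof.
move=> /compact_near_coveringP cA.
(* Each x lies in all large finite sets [B], with {x} as neighbourhood; compactness, in its
   near-covering form, makes this uniform, so one finite [B] contains [A]. *)
have [x Ax|B _ /(_ B (fsubset_refl B)) AB] :=
    cA _ (@totally T) (fun B => [set x | x \in B]) _ _.
  exists ([set x], [set B | ([fset x] `<=` B)%fset]) => /=.
    by split; [exact: discrete_set1|exists [fset x]%fset].
  by move=> [_ B] /= [-> /fsubsetP]; apply; rewrite inE.
exact: (sub_finite_set AB (finite_fset B)).
Qed.

(** * The compact space associated with a set of pairs *)

Section Grid.
Context (R : realType) (G : choiceType) (E : set (G * G)).
Local Notation opc := (one_point_compactification (discrete_topology G)).

(* [None] is the point at infinity. *)
Definition grid : set (opc * opc) :=
  [set p | forall a b, p = (Some a, Some b) -> E (a, b)].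

Lemma nbhs_isolated (a : G) : nbhs (Some a : opc) [set (Some a : opc)].
Proof.
rewrite -image_set1; apply: one_point_compactification_some_nbhs.
exact: discrete_set1.
Qed.

Arguments nbhs_isolated a : clear implicits.

Lemma nbhs_infty (S : set G) : finite_set S ->
  nbhs (None : opc) [set x | forall a, S a -> x <> Some a].
Proof.
move=> fS; exists (S : set (discrete_topology G)).
  by split; [exact: finite_compact|exact: discrete_closed].
move=> _ [[a Sa <-] b Sb [ab]|-> //].
by apply: Sa; rewrite ab.
Qed.

(** A pair outside the grid has two finite coordinates, so it is an isolated point of the
    product. *)
Lemma grid_closed : closed grid.
Proof.
rewrite -[grid]setCK; apply: open_closedC; rewrite openE => -[x y] /= nxy.
have [a [b [xa yb nE]]] : exists a b, [/\ x = Some a, y = Some b & ~ E (a, b)].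
  apply: contrapT => H; apply: nxy => a b [xa yb].
  by apply: contrapT => nE; apply: H; exists a, b.
exists ([set (Some a : opc)], [set (Some b : opc)]) => /=.
  by rewrite xa yb; split; exact: nbhs_isolated.
move=> [_ _] /= [-> ->]; apply: contra_not nE; exact.
Qed.

Lemma grid_compact : compact [set: grid].
Proof.
apply: set_type_compact.
apply: (subclosed_compact grid_closed (B := [set: opc] `*` [set: opc])).
  by apply: compact_setX; exact: one_point_compactification_compact.
by [].
Qed.

Lemma grid_fst_continuous : continuous (fun p : grid => (set_val p).1 : opc).
Proof.
move=> p; apply: (@continuous_comp grid _ _ set_val fst); first exact: initial_continuous.
exact: cvg_fst.
Qed.

Lemma grid_snd_continuous : continuous (fun p : grid => (set_val p).2 : opc).
Proof.
move=> p; apply: (@continuous_comp grid _ _ set_val snd); first exact: initial_continuous.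
exact: cvg_snd.
Qed.

Definition point_ind (a : G) : opc -> R^o := fun x => (x == Some a)%:R.

Lemma point_ind_continuous a : continuous (point_ind a).
Proof.
move=> x; apply: (@cvg_near_cst _ _ _ _ (nbhs x)).
case: x => [c|]; first by apply: (filterS _ (nbhs_isolated c)) => x ->.
apply: (filterS _ (nbhs_infty (finite_set1 a))) => x /(_ a erefl) /eqP/negbTE xa.
by rewrite /point_ind xa.
Qed.

Local Notation H := (ell2 R (bool * G)%type).

(** The tag [b] selects one of two mutually orthogonal copies of the basis, one per coordinate of
    the grid, so that a sum of two such vectors determines both points. *)
Definition basis_or_0 (b : bool) (x : opc) : H :=
  if x is Some a then delta R ((b, a) : (bool * G)%type) else 0.

(** Finite points are isolated; at infinity, [dual_delta_finite] leaves only finitely many points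
    where the functional is not small. *)
Lemma basis_or_0_continuous b (phi : dual H) :
  continuous (fun x => sval phi (basis_or_0 b x) : R^o).
Proof.
move=> [a|].
  apply: (@cvg_near_cst _ _ _ _ (nbhs (Some a : opc))).
  by apply: (filterS _ (nbhs_isolated a)) => x ->.
apply/(@cvgrPdist_lt _ _ _ (nbhs (None : opc))) => e e0.
have fS : finite_set [set a | e <= `|sval phi (delta R (b, a))|].
  rewrite -[X in finite_set X]/((fun a : G => (b, a)) @^-1` [set i | e <= `|sval phi (delta R i)|]).
  apply: finite_preimage; last exact: dual_delta_finite.
  by move=> ? ? _ _ [].
apply: (filterS _ (nbhs_infty fS)) => -[a|] /= Ha; rewrite linear0 sub0r normrN.
  by rewrite ltNge; apply/negP => /Ha.
by rewrite normr0.
Qed.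

Definition grid_embed (p : opc * opc) : H := basis_or_0 true p.1 + basis_or_0 false p.2.

Lemma grid_embed_continuous :
  continuous (fun p : grid => grid_embed (set_val p) : weak_topology H).
Proof.
apply: weak_topology_continuous => phi p.
rewrite (_ : (fun t => _) = (fun t : grid => sval phi (basis_or_0 true (set_val t).1) : R^o) \+
  (fun t : grid => sval phi (basis_or_0 false (set_val t).2) : R^o)); last first.
  by apply/funext => t; exact: linearD.
apply: continuousD.
  exact: (continuous_comp (@grid_fst_continuous p) (@basis_or_0_continuous true phi _)).
exact: (continuous_comp (@grid_snd_continuous p) (@basis_or_0_continuous false phi _)).
Qed.

Lemma grid_embedE p (b : bool) a :
  val (grid_embed p) (b, a) = point_ind a (if b then p.1 else p.2).
Proof.
rewrite -[LHS]/(val (basis_or_0 true p.1) (b, a) + val (basis_or_0 false p.2) (b, a)).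
have basisE b' x : val (basis_or_0 b' x) (b, a) = (b == b')%:R * point_ind a x.
  case: x => [c|] /=; last by rewrite /point_ind mulr0.
  by rewrite /delta_fun /point_ind xpair_eqE -natrM mulnb [a == c]eq_sym.
by rewrite !basisE; case: b {basisE}; rewrite mul1r mul0r ?addr0 ?add0r.
Qed.

Lemma grid_embed_inj : injective grid_embed.
Proof.
(* The indicators separate points, infinity being where all of them vanish. *)
have inj (x y : opc) : (forall a, point_ind a x = point_ind a y) -> x = y.
  case: x => [a|]; case: y => [c|]//.
  - move=> /(_ a); rewrite /point_ind eqxx.
    by case: (Some c =P Some a) => [->//|_] /eqP; rewrite oner_eq0.
  - by move=> /(_ a)/eqP; rewrite /point_ind eqxx oner_eq0.
  - by move=> /(_ c)/eqP; rewrite /point_ind eqxx eq_sym oner_eq0.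
move=> [x y] [x' y'] pq; congr pair; apply: inj => a.
  by rewrite -(grid_embedE (x, y) true) pq grid_embedE.
by rewrite -(grid_embedE (x, y) false) pq grid_embedE.
Qed.

Lemma grid_uniform_eberlein : uniform_eberlein R grid.
Proof.
split; first exact: grid_compact.
pose A : set (weak_topology H) := grid_embed @` grid.
exists H, A; split; first exact: ell2_hilbert.
have fA (p : grid) : grid_embed (set_val p) \in A.
  by apply/mem_set; exists (set_val p) => //; exact: set_valP.
pose f (p : grid) : A := exist (fun y => y \in A) (grid_embed (set_val p)) (fA p).
have /choice[g gP] : forall y : A, exists p : grid, grid_embed (set_val p) = set_val y.
  by move=> y; have [p gp py] := set_valP y; exists (exist _ p (mem_set gp)).
have gK : cancel g f by move=> y; apply: val_inj; exact: gP.
have fK : cancel f g.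
  by move=> p; apply: val_inj; apply: grid_embed_inj; rewrite [LHS]gP.
have cf : continuous f.
  move=> p; apply: cvg_initial; [exact: (@fmap_filter _ _ f _ (nbhs_filter (p : grid)))|].
  exact: (@grid_embed_continuous p).
exists f, g; split => //.
apply: (compact_inverse_continuous grid_compact _ cf) => //.
(* Coordinate functionals are weakly continuous and separate vectors, so the image is Hausdorff. *)
apply: (@separated_hausdorff R) => x y xy.
have [i xyi] : exists i, val (set_val x : H) i <> val (set_val y : H) i.
  apply: contrapT => H'; apply: xy; apply: val_inj; apply: val_inj; apply/funext => i.
  by apply: contrapT => ?; apply: H'; exists i.
exists (fun z : A => sval (coord_dual R i) (set_val z)) => //.
move=> z; apply: (@continuous_comp A (weak_topology H) R^o set_val (sval (coord_dual R i))).
  exact: initial_continuous.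
exact: dual_weak_continuous.
Qed.

End Grid.

Arguments nbhs_isolated {G} a _ _.

(** * A base of the grid indexed by the continuum *)

Section GridWeight.
Variable E : set (continuum * continuum).
Local Notation opc := (one_point_compactification (discrete_topology (nat -> bool))).
Local Notation grid := (@grid (nat -> bool) E).

(** A binary sequence is read as a nat by nat matrix with row [i] extracted, so that one point of
    the continuum codes a whole sequence of points. *)
Definition decode (c : continuum) (i : nat) : continuum := fun j => c (choice.pickle (i, j)).

Lemma decode_surj (D : nat -> continuum) : exists c, forall i, decode c i = D i.
Proof.
exists (fun n => if choice.unpickle n is Some (i, j) then D i j else false) => i.
by apply/funext => j; rewrite /decode choice.pickleK.
Qed.

(* A code may exclude infinitely many points; the sets that are not open are left
   out of the base in [grid_weight]. *)
Definition coded_nbhs (c : continuum) : set opc :=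
  if decode c 0 0 then [set Some (decode c 1)]
  else [set x | forall i, x <> Some (decode c i.+1)].

Lemma coded_nbhs_basis (x : opc) (P : set opc) : nbhs x P ->
  exists c, [/\ open (coded_nbhs c), coded_nbhs c x & coded_nbhs c `<=` P].
Proof.
case: x => [a|].
  (* Row 0 starts with [true], which selects the singleton case, and row 1 is the point [a]. *)
  have [c cE] := decode_surj (fun i => if i is 0%N then fun _ => true else a).
  move=> nP; exists c; rewrite /coded_nbhs !cE; split=> //; last first.
    by move=> _ ->; exact: (nbhs_singleton nP).
  rewrite -image_set1; apply: one_point_compactification_open_some.
  exact: discrete_open.
case=> W [cW _] WP.
have /finite_seqP[s Ws] := compact_discrete_finite cW.
pose z : continuum := fun _ => false.
(* Row 0 is [z], whose first entry [false] selects the case of excluded points. The rows past the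
   end of [s] also default to [z], so [z] is excluded along with [s]; this only shrinks the
   neighbourhood. *)
have [c cE] := decode_surj (fun i => if i is j.+1 then nth z s j else z).
exists c; rewrite /coded_nbhs cE /=; split => //; last first.
  move=> [a|] Ha; apply: WP; last by right.
  left; exists a => //; rewrite Ws /= => /(nthP z)[i _ ai].
  by apply: (Ha i); rewrite cE ai.
rewrite openE => -[a|] /= Ha.
  by apply: (filterS _ (nbhs_isolated a)) => _ ->.
have fS : finite_set [set` z :: s] by exact: finite_seq.
apply: (filterS _ (nbhs_infty fS)) => x Hx i; rewrite cE; apply: Hx.
rewrite /= inE; have [si|si] := ltnP i (size s); last by rewrite nth_default ?eqxx.
by rewrite mem_nth ?orbT.
Qed.

(** Traces on the grid of products of two coded neighbourhoods form a base once restricted to the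
    open ones, and a single code carries both factors. *)
Lemma grid_weight : weight_le grid continuum.
Proof.
pose box (c : continuum) : set grid := [set p |
  coded_nbhs (decode c 0) (set_val p).1 /\ coded_nbhs (decode c 1) (set_val p).2].
exists [set U | open U /\ range box U]; split; last first.
  apply: card_le_trans (card_image_le box setT).
  by apply: subset_card_le => U [].
split=> [U []//|p V [_ [[W oW <-] Wp WV]]].
have [[P Q] /= [nP nQ] PQW] : nbhs (set_val p) W by exact: open_nbhs_nbhs.
have [c [oc cp cP]] := coded_nbhs_basis nP.
have [d [od dp dQ]] := coded_nbhs_basis nQ.
have [e eE] := decode_surj (fun i => if i is 0%N then c else d).
exists (box e); last first.
  move=> q; rewrite /box /= !eE => -[cq dq]; apply: WV; apply: PQW.
  by split; [exact: cP|exact: dQ].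
split; last by rewrite /box /= !eE.
split; last by exists e.
rewrite /box !eE.
apply: (@openI grid ((fun q => (set_val q).1) @^-1` coded_nbhs c)
                    ((fun q => (set_val q).2) @^-1` coded_nbhs d)).
  by apply: open_comp => // q _; exact: grid_fst_continuous.
by apply: open_comp => // q _; exact: grid_snd_continuous.
Qed.

End GridWeight.

(** * Norms of sums of two indicator functions on the grid *)

Section GridFunctions.
Context (R : realType) (G : choiceType) (E : set (G * G)).
Local Notation C := (continuous_functions R (@grid_compact _ E)).

Definition side (b : bool) (a : G) (p : grid E) : R^o :=
  point_ind R a (if b then (set_val p).1 else (set_val p).2).

Fact side_continuous b a : side b a \in @continuous_pred R (grid E).
Proof.
apply/continuous_predP => p; case: b.
  exact: (continuous_comp (@grid_fst_continuous _ _ p) (@point_ind_continuous _ _ a _)).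
exact: (continuous_comp (@grid_snd_continuous _ _ p) (@point_ind_continuous _ _ a _)).
Qed.

Definition side_fun b a : C := Sub (side b a) (side_continuous b a).

(** The point (a, b) then belongs to the grid, and both indicators are 1 there. *)
Lemma norm_side_fun_in a b : E (a, b) -> 2 <= `|side_fun true a + side_fun false b|.
Proof.
move=> Eab.
have gab : grid E (Some a, Some b) by move=> _ _ [<- <-].
rewrite -[leRHS]/(sup_norm (side_fun true a + side_fun false b)).
pose p : grid E := exist (fun p => p \in grid E) _ (mem_set gab).
apply: le_trans (sup_norm_ub (side_fun true a + side_fun false b) p).
rewrite [val _ _](_ : _ = 2) ?ger0_norm//.
rewrite -[LHS]/(side true a p + side false b p) /side /point_ind /= !eqxx.
by rewrite -natrD.
Qed.

(** Both indicators can be 1 only at (a, b), which the grid omits. *)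
Lemma norm_side_fun_notin a b : ~ E (a, b) -> `|side_fun true a + side_fun false b| <= 1.
Proof.
move=> nE; rewrite -[leLHS]/(sup_norm (side_fun true a + side_fun false b)).
apply: sup_norm_le => // p.
rewrite [val _ _](_ : _ = (((set_val p).1 == Some a) + ((set_val p).2 == Some b))%:R); last first.
  by rewrite natrD.
rewrite ger0_norm// (ler_nat R _ 1).
case: eqP => // p1; case: eqP => // p2; case: nE.
by apply: (set_valP p); rewrite -p1 -p2 -surjective_pairing.
Qed.

End GridFunctions.

(** * Measurability *)

Section LimsupMeasurable.
Context (R : realType) (T : pointedType).

Lemma rectangles_limsup (x y : T -> nat -> R) (r : R) :
  <<s @rectangles T >> [set p | forall m, exists2 n, (m <= n)%N & r < `|x p.1 n + y p.2 n|].
Proof.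
pose M := g_sigma_algebraType (@rectangles T).
(* Any subset of [T] can be a side of a rectangle, so an arbitrary function of one coordinate is
   measurable. *)
have mx n : measurable_fun [set: M] (fun p : M => x p.1 n).
  move=> _ A _; rewrite setTI; apply: sub_sigma_algebra.
  exists [set t | A (x t n)] => //; exists setT => //.
  by apply/seteqP; split=> [[s t] []|[s t]].
have my n : measurable_fun [set: M] (fun p : M => y p.2 n).
  move=> _ A _; rewrite setTI; apply: sub_sigma_algebra.
  exists setT => //; exists [set t | A (y t n)] => //.
  by apply/seteqP; split=> [[s t] []|[s t]].
rewrite -[<<s _ >> _]/(measurable (_ : set M)).
(* Occurring for infinitely many n is a countable intersection of countable unions. *)
rewrite (_ : [set p | _] = \bigcap_m \bigcup_(n in [set n | (m <= n)%N])
    [set p : M | r < `|x p.1 n + y p.2 n|]); last first.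
  apply/seteqP; split=> p H m; first by move=> _; have [n mn rn] := H m; exists n.
  by have [n mn rn] := H m I; exists n.
apply: bigcap_measurable => [|m _]; first by exists 0%N.
apply: bigcup_measurable => n _.
have mn : measurable_fun [set: M] (fun p : M => `|x p.1 n + y p.2 n|).
  by apply: measurableT_comp => //; exact: measurable_realfun.measurable_funD.
have := mn measurableT _ (measurable_itv `]r, +oo[).
by congr measurable; apply/seteqP; split=> p /=; rewrite in_itv /= andbT => //; case.
Qed.

End LimsupMeasurable.

(** * From the isometric embedding to the Kunen property *)

Theorem theorem3p2 (R : realType) :
  (forall (K : topologicalType) (cK : compact [set: K]),
     uniform_eberlein R K -> weight_le K continuum ->
     embeds_isometrically (continuous_functions R cK) (linf_c0 R)) ->
  kunen continuum.
Proof.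
move=> embed E.
have [T Tiso] := embed _ (@grid_compact _ E) (grid_uniform_eberlein R E) (grid_weight E).
(* Representatives are chosen for each indicator separately, so each depends on one coordinate only;
   by linearity their sums represent the images of the sums. *)
pose x b a : linf R := repr (T (side_fun R E b a)).
have normx a b : limsup_norm (x true a + x false b) = `|side_fun R E true a + side_fun R E false b|.
  rewrite -Tiso linearD -linf_c0_normE piD_linf_c0 !reprK.
  by [].
(* The threshold 3/2 lies strictly between the norm bounds 1, off [E], and 2, on [E]. *)
rewrite (_ : E = [set p | forall m, exists2 n, (m <= n)%N & 3 / 2 < `|val (x true p.1) n + val (x false p.2) n|]).
  exact: (@rectangles_limsup R (nat -> bool) (fun a => val (x true a)) (fun b => val (x false b))  (3 / 2)).
apply/seteqP; split=> [[a b] Eab m|[a b] H] /=.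
  (* If no value from index [m] on exceeded 3/2, the limit superior would be at most 3/2, hence
     below 2. *)
  apply: contrapT => nH.
  have := norm_side_fun_in R Eab; rewrite -normx; apply/negP; rewrite -ltNge.
  apply: (@le_lt_trans _ _ (3 / 2)); last by lra.
  apply: limsup_norm_le; exists m => // n mn.
  rewrite leNgt; apply/negP => H; apply: nH; by exists n.
(* Off [E] the limit superior is at most 1, so the values are eventually below 3/2, contradicting
   [H]. *)
apply: contrapT => nE; have := norm_side_fun_notin R nE; rewrite -normx => l1.
have [|N _ HN] := @limsup_norm_lt _ (x true a + x false b) (3 / 2); first by lra.
have [n Nn] := H N; apply/negP; rewrite -leNgt; apply/ltW; exact: HN.
Qed.
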